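(* Let $\Omega\in\mathbb{R}$ and let $\phi\in C^3(\mathbb{R}^2)$ satisfy $\nabla^\perp\phi\cdot\nabla\Delta\phi=0$ in $\mathbb{R}^2$ and $\phi(x)=-\frac{\Omega}{2}|x|^2$ for all $x$ outside some ball. Consider the (nonempty, closed) set $$\mathcal I:=\{r\in[0,\infty): \phi(x)=\phi(y)\text{ for all }x,y\in\mathbb{R}^2\text{ with }|x|=|y|=r\}.$$ If $r\in\partial\mathcal I\setminus\{0\}$ is not an isolated point of $\mathcal I$, then $\nabla\phi=0$ on the circle $\partial B_r(0)=\{x:|x|=r\}$.
   Context: $\nabla^\perp:=(-\partial_{x_2},\partial_{x_1})$. The boundary $\partial\mathcal I$ is taken in $[0,\infty)$. *)

(* Defs.v *)
From Stdlib Require Import Reals.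
From Coquelicot Require Import Coquelicot.
Open Scope R_scope.

Definition D1 (f : R -> R -> R) : R -> R -> R :=
  fun x y => Derive (fun t => f t y) x.
Definition D2 (f : R -> R -> R) : R -> R -> R :=
  fun x y => Derive (fun t => f x t) y.

Definition cont2 (f : R -> R -> R) : Prop :=
  forall x y : R, continuous (fun p : R * R => f (fst p) (snd p)) (x, y).

Fixpoint Ck (k : nat) (f : R -> R -> R) : Prop :=
  match k with
  | O => cont2 f
  | S k' => cont2 f /\
            (forall x y, ex_derive (fun t => f t y) x /\ ex_derive (fun t => f x t) y) /\
            Ck k' (D1 f) /\ Ck k' (D2 f)
  end.

Definition Lap (f : R -> R -> R) : R -> R -> R :=
  fun x y => D1 (D1 f) x y + D2 (D2 f) x y.

Definition nrm (x y : R) : R := sqrt (x ^ 2 + y ^ 2).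

Definition Iset (phi : R -> R -> R) (r : R) : Prop :=
  0 <= r /\ forall x1 y1 x2 y2, nrm x1 y1 = r -> nrm x2 y2 = r -> phi x1 y1 = phi x2 y2.

Definition in_closure (P : R -> Prop) (r : R) : Prop :=
  forall eps, 0 < eps -> exists s, P s /\ Rabs (s - r) < eps.

Definition rel_boundary (A : R -> Prop) (r : R) : Prop :=
  0 <= r /\ in_closure A r /\ in_closure (fun s => 0 <= s /\ ~ A s) r.

Definition non_isolated (A : R -> Prop) (r : R) : Prop :=
  A r /\ forall eps, 0 < eps -> exists s, A s /\ s <> r /\ Rabs (s - r) < eps.

(* Main.v *)
Require Import Defs.
From Stdlib Require Import Reals.
From Coquelicot Require Import Coquelicot.
From Stdlib Require Import Lra Psatz FunctionalExtensionality.
Open Scope R_scope.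

(** In log-polar coordinates x = r exp(sg t) (cos th, sin th), sg = 1 or -1, put
    u = phi and w = d_th u.  The Laplacian becomes conformal to d_t^2 + d_th^2, and
    since the Jacobian of (phi, Delta phi) vanishes, w solves a linear equation
    w_tt + w_thth = V w wherever u_t <> 0.  As w = 0 on every circle whose radius lies
    in I, and such radii accumulate at r, both w and w_t vanish at t = 0.  Hence u_t is
    constant on the circle of radius r.  If that constant is not 0, then V is bounded
    near the circle and Cauchy uniqueness (a Carleman estimate) gives w = 0 on both
    sides, so that r is interior to I.  Therefore u_t = u_th = 0 on the circle. *)

(** * Calculus of C^k functions of two real variables *)

Lemma Ck_cont2 (k : nat) (f : R -> R -> R) : Ck k f -> cont2 f.
Proof. destruct k; [easy | now intros [H _]]. Qed.

Lemma Ck_pred (k : nat) (f : R -> R -> R) : Ck (S k) f -> Ck k f.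
Proof.
revert f; induction k as [|k IH]; intros f H; [exact (Ck_cont2 _ _ H)|].
destruct H as (H0 & H1 & H2 & H3).
repeat split; auto; try (apply H1); now apply IH.
Qed.

Lemma Ck_D1 (k : nat) (f : R -> R -> R) : Ck (S k) f -> Ck k (D1 f).
Proof. now intros (_ & _ & H & _). Qed.

Lemma Ck_D2 (k : nat) (f : R -> R -> R) : Ck (S k) f -> Ck k (D2 f).
Proof. now intros (_ & _ & _ & H). Qed.

Lemma is_derive_D1 (k : nat) (f : R -> R -> R) (x y : R) :
  Ck (S k) f -> is_derive (fun t => f t y) x (D1 f x y).
Proof. intros (_ & H & _); apply Derive_correct, H. Qed.

Lemma is_derive_D2 (k : nat) (f : R -> R -> R) (x y : R) :
  Ck (S k) f -> is_derive (fun t => f x t) y (D2 f x y).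
Proof. intros (_ & H & _); apply Derive_correct, H. Qed.

(** Lets inductions on [k] name the partial derivatives explicitly. [Ck] speaks of [D1 f] and [D2 f]
    as functions, so extensionality has to turn the pointwise derivatives into equalities of
    functions. *)
Lemma Ck_intro (k : nat) (f f1 f2 : R -> R -> R) :
  cont2 f ->
  (forall x y, is_derive (fun t => f t y) x (f1 x y)) ->
  (forall x y, is_derive (fun t => f x t) y (f2 x y)) ->
  Ck k f1 -> Ck k f2 -> Ck (S k) f /\ D1 f = f1 /\ D2 f = f2.
Proof.
intros Hc H1 H2 K1 K2.
assert (E1 : D1 f = f1) by
  (extensionality x; extensionality y; apply is_derive_unique, H1).
assert (E2 : D2 f = f2) by
  (extensionality x; extensionality y; apply is_derive_unique, H2).
split; [|now split].
split; [exact Hc|split].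
- intros x y; split; [exists (f1 x y) | exists (f2 x y)]; auto.
- now rewrite E1, E2.
Qed.

Lemma Ck_const (k : nat) (c : R) : Ck k (fun _ _ => c).
Proof.
revert c; induction k as [|k IH]; intros c.
- intros x y; apply continuous_const.
- apply (Ck_intro k (fun _ _ => c) (fun _ _ => 0) (fun _ _ => 0)); try apply IH.
  + intros x y; apply continuous_const.
  + intros x y; apply (is_derive_const c).
  + intros x y; apply (is_derive_const c).
Qed.

Lemma cont2_plus (f g : R -> R -> R) :
  cont2 f -> cont2 g -> cont2 (fun x y => f x y + g x y).
Proof.
intros Hf Hg x y.
apply (continuous_plus (fun p => f (fst p) (snd p)) (fun p => g (fst p) (snd p))); auto.
Qed.

Lemma cont2_mult (f g : R -> R -> R) :
  cont2 f -> cont2 g -> cont2 (fun x y => f x y * g x y).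
Proof.
intros Hf Hg x y.
apply (continuous_mult (fun p => f (fst p) (snd p)) (fun p => g (fst p) (snd p))); auto.
Qed.

Lemma cont2_comp (f X Y : R -> R -> R) :
  cont2 f -> cont2 X -> cont2 Y -> cont2 (fun x y => f (X x y) (Y x y)).
Proof.
intros Hf HX HY x y.
apply (continuous_comp_2 (fun p => X (fst p) (snd p)) (fun p => Y (fst p) (snd p)) f);
  auto.
Qed.

Lemma Ck_plus (k : nat) (f g : R -> R -> R) :
  Ck k f -> Ck k g -> Ck k (fun x y => f x y + g x y).
Proof.
revert f g; induction k as [|k IH]; intros f g Hf Hg; [now apply cont2_plus|].
apply (Ck_intro k _ (fun x y => D1 f x y + D1 g x y) (fun x y => D2 f x y + D2 g x y)).
- apply cont2_plus; eapply Ck_cont2; eassumption.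
- intros x y; apply (is_derive_plus (fun t => f t y) (fun t => g t y));
    eapply is_derive_D1; eassumption.
- intros x y; apply (is_derive_plus (fun t => f x t) (fun t => g x t));
    eapply is_derive_D2; eassumption.
- now apply IH; apply Ck_D1.
- now apply IH; apply Ck_D2.
Qed.

Lemma Ck_mult (k : nat) (f g : R -> R -> R) :
  Ck k f -> Ck k g -> Ck k (fun x y => f x y * g x y).
Proof.
revert f g; induction k as [|k IH]; intros f g Hf Hg; [now apply cont2_mult|].
apply (Ck_intro k _ (fun x y => D1 f x y * g x y + f x y * D1 g x y)
                    (fun x y => D2 f x y * g x y + f x y * D2 g x y)).
- apply cont2_mult; eapply Ck_cont2; eassumption.
- intros x y; apply (is_derive_mult (fun t => f t y) (fun t => g t y));
    try (eapply is_derive_D1; eassumption); exact Rmult_comm.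
- intros x y; apply (is_derive_mult (fun t => f x t) (fun t => g x t));
    try (eapply is_derive_D2; eassumption); exact Rmult_comm.
- apply Ck_plus; apply IH; auto using Ck_D1, Ck_pred.
- apply Ck_plus; apply IH; auto using Ck_D2, Ck_pred.
Qed.

(** Continuity of a partial derivative gives differentiability in the full sense, which the chain
    rule [is_derive_comp2] needs. *)
Lemma C1_differentiable (f : R -> R -> R) (x y : R) :
  Ck 1 f -> differentiable_pt_lim f x y (D1 f x y) (D2 f x y).
Proof.
intros H; apply filterdiff_differentiable_pt_lim.
apply (is_derive_filterdiff f x y (D1 f) (D2 f x y)).
- apply filter_forall; intros p; eapply is_derive_D1, H.
- eapply is_derive_D2, H.
- apply (Ck_cont2 0), Ck_D1, H.
Qed.

Lemma is_derive_comp2 (f : R -> R -> R) (X Y : R -> R) (t dX dY : R) :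
  Ck 1 f -> is_derive X t dX -> is_derive Y t dY ->
  is_derive (fun t => f (X t) (Y t)) t
    (D1 f (X t) (Y t) * dX + D2 f (X t) (Y t) * dY).
Proof.
intros Hf HX HY; apply is_derive_Reals, derivable_pt_lim_comp_2d.
- now apply C1_differentiable.
- now apply is_derive_Reals.
- now apply is_derive_Reals.
Qed.

Lemma Ck_le1 (k : nat) (f : R -> R -> R) : Ck (S k) f -> Ck 1 f.
Proof. induction k as [|k IH]; auto using Ck_pred. Qed.

Lemma Ck_comp (k : nat) (f X Y : R -> R -> R) :
  Ck k f -> Ck k X -> Ck k Y -> Ck k (fun x y => f (X x y) (Y x y)).
Proof.
revert f; induction k as [|k IH]; intros f Hf HX HY; [now apply cont2_comp|].
apply (Ck_intro k _
  (fun x y => D1 f (X x y) (Y x y) * D1 X x y + D2 f (X x y) (Y x y) * D1 Y x y)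
  (fun x y => D1 f (X x y) (Y x y) * D2 X x y + D2 f (X x y) (Y x y) * D2 Y x y)).
- apply cont2_comp; eapply Ck_cont2; eassumption.
- intros x y; apply (is_derive_comp2 f (fun t => X t y) (fun t => Y t y)).
  + eapply Ck_le1, Hf.
  + eapply is_derive_D1, HX.
  + eapply is_derive_D1, HY.
- intros x y; apply (is_derive_comp2 f (fun t => X x t) (fun t => Y x t)).
  + eapply Ck_le1, Hf.
  + eapply is_derive_D2, HX.
  + eapply is_derive_D2, HY.
- apply Ck_plus; apply Ck_mult; auto using Ck_D1, Ck_D2, Ck_pred.
- apply Ck_plus; apply Ck_mult; auto using Ck_D1, Ck_D2, Ck_pred.
Qed.

Lemma cont2_continuity_2d_pt (f : R -> R -> R) (x y : R) :
  cont2 f -> continuity_2d_pt f x y.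
Proof. intros H; apply continuity_2d_pt_filterlim; exact (H x y). Qed.

Lemma D1_D2_comm (f : R -> R -> R) : Ck 2 f -> D1 (D2 f) = D2 (D1 f).
Proof.
intros H; extensionality x; extensionality y.
apply (Schwarz f x y).
- apply locally_2d_forall; intros u v; repeat split.
  + eexists; eapply (is_derive_D1 1), H.
  + eexists; eapply (is_derive_D2 1), H.
  + eexists; eapply (is_derive_D1 0 (D2 f)), Ck_D2, H.
  + eexists; eapply (is_derive_D2 0 (D1 f)), Ck_D1, H.
- apply cont2_continuity_2d_pt, (Ck_D1 0), Ck_D2, H.
- apply cont2_continuity_2d_pt, (Ck_D2 0), Ck_D1, H.
Qed.

Lemma cont2_continuous_2 (f : R -> R -> R) (x y : R) :
  cont2 f -> continuous (fun t => f x t) y.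
Proof.
intros H; apply (continuous_comp_2 (fun _ => x) (fun t => t) f).
- apply continuous_const.
- apply continuous_id.
- exact (H x y).
Qed.

Lemma D_mult (f g : R -> R -> R) : Ck 1 f -> Ck 1 g ->
  D1 (fun x y => f x y * g x y) = (fun x y => D1 f x y * g x y + f x y * D1 g x y) /\
  D2 (fun x y => f x y * g x y) = (fun x y => D2 f x y * g x y + f x y * D2 g x y).
Proof.
intros Hf Hg; split; extensionality x; extensionality y; apply is_derive_unique.
- apply (is_derive_mult (fun t => f t y) (fun t => g t y));
    try (eapply is_derive_D1; eassumption); exact Rmult_comm.
- apply (is_derive_mult (fun t => f x t) (fun t => g x t));
    try (eapply is_derive_D2; eassumption); exact Rmult_comm.
Qed.

(** * Integrals over a slice of constant t *)

Definition slice_int (c : R) (f : R -> R -> R) (t : R) : R := RInt (fun x => f t x) 0 c.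

Lemma ex_RInt_cont2 (f : R -> R -> R) (t a b : R) :
  cont2 f -> ex_RInt (fun x => f t x) a b.
Proof.
intros Hf; apply (ex_RInt_continuous (V := R_CompleteNormedModule)).
intros z _; now apply cont2_continuous_2.
Qed.

Lemma slice_int_ext (c : R) (f g : R -> R -> R) (t : R) :
  (forall x, f t x = g t x) -> slice_int c f t = slice_int c g t.
Proof. intros H; apply RInt_ext; intros; apply H. Qed.

Lemma slice_int_plus (c : R) (f g : R -> R -> R) (t : R) : cont2 f -> cont2 g ->
  slice_int c (fun t x => f t x + g t x) t = slice_int c f t + slice_int c g t.
Proof.
intros Hf Hg; apply (RInt_plus (fun x => f t x) (fun x => g t x));
  now apply ex_RInt_cont2.
Qed.

Lemma slice_int_scal (c k : R) (f : R -> R -> R) (t : R) : cont2 f ->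
  slice_int c (fun t x => k * f t x) t = k * slice_int c f t.
Proof.
intros Hf; apply (RInt_scal (fun x => f t x)); now apply ex_RInt_cont2.
Qed.

Lemma slice_int_le (c : R) (f g : R -> R -> R) (t : R) : 0 <= c -> cont2 f -> cont2 g ->
  (forall x, 0 < x < c -> f t x <= g t x) -> slice_int c f t <= slice_int c g t.
Proof. intros Hc Hf Hg H; apply RInt_le; auto using ex_RInt_cont2. Qed.

Lemma slice_int_ge_0 (c : R) (f : R -> R -> R) (t : R) : 0 <= c -> cont2 f ->
  (forall x, 0 <= f t x) -> 0 <= slice_int c f t.
Proof. intros Hc Hf H; apply RInt_ge_0; auto using ex_RInt_cont2. Qed.

Lemma is_derive_slice_int (c : R) (f : R -> R -> R) (t : R) :
  Ck 1 f -> is_derive (slice_int c f) t (slice_int c (D1 f) t).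
Proof.
intros Hf; apply (is_derive_RInt_param f 0 c t).
- apply filter_forall; intros x y _; eexists; eapply is_derive_D1, Hf.
- intros y _; apply cont2_continuity_2d_pt, (Ck_D1 0), Hf.
- apply filter_forall; intros x; apply ex_RInt_cont2, (Ck_cont2 1), Hf.
Qed.

(** The integral of the x-derivative of [f * g] is the difference of its end values, which is 0
    because both factors agree at 0 and [c]. *)
Lemma slice_int_by_parts (c : R) (f g : R -> R -> R) (t : R) :
  Ck 1 f -> Ck 1 g -> f t c = f t 0 -> g t c = g t 0 ->
  slice_int c (fun t x => f t x * D2 g t x) t =
  - slice_int c (fun t x => D2 f t x * g t x) t.
Proof.
intros Hf Hg Ef Eg.
assert (C1 : cont2 (fun t x => f t x * D2 g t x))
  by (apply cont2_mult; [apply (Ck_cont2 1) | apply (Ck_D2 0)]; auto).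
assert (C2 : cont2 (fun t x => D2 f t x * g t x))
  by (apply cont2_mult; [apply (Ck_D2 0) | apply (Ck_cont2 1)]; auto).
enough (slice_int c (fun t x => D2 f t x * g t x + f t x * D2 g t x) t = 0)
  by (rewrite (slice_int_plus c (fun t x => D2 f t x * g t x)) in H; auto; lra).
assert (E : f t c * g t c - f t 0 * g t 0 = 0) by (rewrite Ef, Eg; ring).
rewrite <- E.
apply is_RInt_unique, (is_RInt_derive (fun x => f t x * g t x)).
- intros x _; apply (is_derive_mult (fun x => f t x) (fun x => g t x));
    try (eapply is_derive_D2; eassumption); exact Rmult_comm.
- intros x _.
  apply (cont2_continuous_2 (fun t x => D2 f t x * g t x + f t x * D2 g t x)).
  now apply cont2_plus.
Qed.

(** Nonnegativity forces every partial integral from 0 to y to vanish. Differentiating in y at [x]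
    recovers [f t x]. *)
Lemma slice_int_eq_0 (c : R) (f : R -> R -> R) (t x : R) :
  cont2 f -> (forall x, 0 <= f t x) -> slice_int c f t = 0 -> 0 < x < c -> f t x = 0.
Proof.
intros Hf Hpos H0 Hx.
assert (HF : forall y, 0 < y < c -> RInt (fun x => f t x) 0 y = 0).
{ intros y Hy.
  assert (H := RInt_Chasles (fun x => f t x) 0 y c (ex_RInt_cont2 f t 0 y Hf)
                 (ex_RInt_cont2 f t y c Hf)).
  change (RInt (fun x => f t x) 0 y + RInt (fun x => f t x) y c = slice_int c f t) in H.
  assert (0 <= RInt (fun x => f t x) 0 y)
    by (apply RInt_ge_0; auto using ex_RInt_cont2; lra).
  assert (0 <= RInt (fun x => f t x) y c)
    by (apply RInt_ge_0; auto using ex_RInt_cont2; lra).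
  lra. }
assert (D : is_derive (fun y => RInt (fun x => f t x) 0 y) x (f t x)).
{ apply (is_derive_RInt (fun x => f t x) _ 0).
  - apply filter_forall; intros y; apply (RInt_correct (fun x => f t x)), ex_RInt_cont2, Hf.
  - now apply cont2_continuous_2. }
apply is_derive_unique in D; rewrite <- D; apply is_derive_unique.
apply (is_derive_ext_loc (fun _ => 0)).
- assert (Hd : 0 < Rmin x (c - x)) by (apply Rmin_glb_lt; lra).
  exists (mkposreal _ Hd); intros y Hy; symmetry; apply HF.
  change (Rabs (y - x) < Rmin x (c - x)) in Hy.
  assert (H1 := Rmin_l x (c - x)); assert (H2 := Rmin_r x (c - x)).
  apply Rabs_def2 in Hy; lra.
- apply (is_derive_const 0).
Qed.

(** * Exponential growth and the Carleman energy estimate *)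

Lemma exp_nondecreasing (x y : R) : x <= y -> exp x <= exp y.
Proof. intros [H | ->]; [left; now apply exp_increasing | right; easy]. Qed.

Lemma exp_ge_pow4 (x : R) : 0 <= x -> (x / 4) ^ 4 <= exp x.
Proof.
intros Hx.
replace (exp x) with (exp (x / 4) ^ 4).
- apply pow_incr; assert (H := exp_ineq1_le (x / 4)); lra.
- simpl; rewrite Rmult_1_r, <- !exp_plus; f_equal; field.
Qed.

(** Supplies the large Carleman parameter: the exponential gain of the weight must beat a boundary
    term that is cubic in the parameter. *)
Lemma exp_not_le_cubic (eta d C t0 : R) : 0 < eta -> 0 < d ->
  exists t, t0 <= t /\ 1 <= t /\ C * t ^ 3 < eta * exp (d * t).
Proof.
intros He Hd.
(* By [exp_ge_pow4] the exponential side is at least [q * t ^ 4], so [C < q * t] is enough. *)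
set (q := eta * (d / 4) ^ 4).
assert (Hq : 0 < q) by (apply Rmult_lt_0_compat; [|apply pow_lt]; lra).
set (t := Rmax (Rmax 1 t0) (C / q + 1)).
assert (H1 : 1 <= t) by (eapply Rle_trans; [|apply Rmax_l]; apply Rmax_l).
assert (H2 : t0 <= t) by (eapply Rle_trans; [|apply Rmax_l]; apply Rmax_r).
assert (H3 : C < q * t).
{ apply Rlt_le_trans with (q * (C / q + 1)).
  - field_simplify; lra.
  - apply Rmult_le_compat_l; [lra | apply Rmax_r]. }
exists t; repeat split; auto.
apply Rlt_le_trans with (eta * (d * t / 4) ^ 4).
- replace (eta * (d * t / 4) ^ 4) with ((q * t) * t ^ 3) by (unfold q; field).
  apply Rmult_lt_compat_r; [apply pow_lt; lra | exact H3].
- apply Rmult_le_compat_l; [lra|]; apply exp_ge_pow4; nra.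
Qed.

(* In the application [f] is the Laplacian of [w] and, with all integrals taken over one
   period at time [t], [a] = int w^2, [b] = int w w_t, [e] = int w_t^2,
   [D] = int (w_t^2 - w_th^2), [g] = int f w, [h] = int f w_t and [k] = int f^2. *)
Section Energy.

Variables (a b e D g h k : R -> R) (T M : R).
Hypothesis Ha : forall t, is_derive a t (2 * b t).
Hypothesis Hb : forall t, is_derive b t (2 * e t - D t + g t).
Hypothesis HD : forall t, is_derive D t (2 * h t).
Hypothesis Hquad : forall t al be, 0 <= k t + al ^ 2 * e t + be ^ 2 * a t
  + 2 * al * h t + 2 * be * g t + 2 * al * be * b t.
Hypothesis Hquad0 : forall t p, 0 <= e t + 2 * p * b t + p ^ 2 * a t.
Hypothesis Hk : forall t, 0 <= t <= T -> k t <= M * a t.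
Hypothesis Ha0 : a 0 = 0.
Hypothesis Hb0 : b 0 = 0.
Hypothesis HD0 : D 0 = 0.
Hypothesis a_ge_0 : forall t, 0 <= a t.

(* For v = exp(tau (t - T - 1)^2 / 2) w this is the total t-derivative part of 2 <S v, A v>,
   where S = d_t^2 + d_th^2 + p^2 and A = - 2 p d_t - tau are the symmetric and
   antisymmetric parts of the Laplacian conjugated by the weight.  The weight is largest
   at t = 0, so the boundary term at T is negligible as tau grows and no cutoff is needed. *)
Definition carleman (tau t : R) : R :=
  let p := tau * (t - (T + 1)) in
  exp (tau * (t - (T + 1)) ^ 2) *
  (- 2 * p * D t - 4 * p ^ 2 * b t - 4 * p ^ 3 * a t - 2 * tau * b t - 2 * tau * p * a t).

Lemma carleman_derive (tau t : R) :
  let p := tau * (t - (T + 1)) in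
  is_derive (carleman tau) t
    (exp (tau * (t - (T + 1)) ^ 2) *
     (- (8 * p ^ 2 + 4 * tau) * e t - (16 * p ^ 3 + 16 * tau * p) * b t
      - (8 * p ^ 4 + 16 * tau * p ^ 2 + 2 * tau ^ 2) * a t
      - (4 * p ^ 2 + 2 * tau) * g t - 4 * p * h t)).
Proof.
intros p; unfold carleman.
auto_derive.
- repeat split; eexists; eauto.
- assert (Ea : Derive (fun x : R => a x) t = 2 * b t) by apply is_derive_unique, Ha.
  assert (Eb : Derive (fun x : R => b x) t = 2 * e t - D t + g t)
    by apply is_derive_unique, Hb.
  assert (ED : Derive (fun x : R => D x) t = 2 * h t) by apply is_derive_unique, HD.
  rewrite Ea, Eb, ED.
  replace ((t + - (T + 1)) * ((t + - (T + 1)) * 1)) with ((t - (T + 1)) ^ 2) by ring.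
  unfold p; ring.
Qed.

(** Half of [Q] absorbs the terms in [g] and [h] and leaves the bracket at most k/2 - 4 tau (e + 2 p
    b + p^2 a) - 4 tau p^2 a. The middle term is nonpositive by [N]. Since p <= -1 and tau >= M, the
    last one dominates k/2 <= M a/2 and still leaves -a. *)
Lemma carleman_derive_le (tau t : R) : 1 <= tau -> M <= tau -> 0 <= t <= T ->
  exists l, is_derive (carleman tau) t l /\
            l <= - (a t * exp (tau * (t - (T + 1)) ^ 2)).
Proof.
intros H1 HM Ht.
eexists; split; [apply carleman_derive|].
set (p := tau * (t - (T + 1))).
rewrite (Rmult_comm (a t)), <- Ropp_mult_distr_r_reverse.
apply Rmult_le_compat_l; [left; apply exp_pos|].
(* [Q] expresses |f - 2 A|^2 >= 0, where A = - 2 p (w_t + p w) - tau w. *)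
assert (Q := Hquad t (4 * p) (4 * p ^ 2 + 2 * tau)).
assert (N := Hquad0 t p).
assert (K := Hk t Ht).
assert (A := a_ge_0 t).
assert (P0 : p <= - 1) by (unfold p; nra).
assert (P : 1 <= p ^ 2) by nra.
assert (N' : 0 <= tau * (e t + 2 * p * b t + p ^ 2 * a t))
  by (apply Rmult_le_pos; lra).
assert (P1 : tau <= tau * p ^ 2) by nra.
assert (P2 : tau * a t <= tau * p ^ 2 * a t) by (apply Rmult_le_compat_r; lra).
assert (P3 : M * a t <= tau * a t) by (apply Rmult_le_compat_r; lra).
assert (P4 : a t <= tau * a t) by nra.
nra.
Qed.

Lemma carleman_decreasing (tau s t : R) : 1 <= tau -> M <= tau ->
  0 <= s -> s <= t -> t <= T -> carleman tau t <= carleman tau s.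
Proof.
intros H1 HM Hs Hst HT.
destruct (MVT_gen (carleman tau) s t (Derive (carleman tau))) as (c & Hc & E).
- intros x Hx; apply Derive_correct; eexists; apply carleman_derive.
- intros x Hx; apply derivable_continuous_pt, ex_derive_Reals_0.
  eexists; apply carleman_derive.
- rewrite Rmin_left, Rmax_right in Hc by lra.
  destruct (carleman_derive_le tau c) as (l & Hl & Hle); try lra.
  rewrite (is_derive_unique _ _ _ Hl) in E.
  assert (0 <= a c * exp (tau * (c - (T + 1)) ^ 2))
    by (apply Rmult_le_pos; [apply a_ge_0 | left; apply exp_pos]).
  nra.
Qed.

(** [carleman tau] starts at 0 and decreases. If [a s] were positive, it would drop after [s] by an
    amount of order exp(tau (s1 - T - 1)^2), whereas at [T] it is at least -C tau^3 exp(tau). As s1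
    < T, the former exponent is larger, a contradiction for large [tau]. *)
Lemma energy_eq_0 (s : R) : 0 <= s < T -> a s = 0.
Proof.
intros Hs.
destruct (Rle_lt_or_eq_dec 0 (a s) (a_ge_0 s)) as [Hpos|]; [exfalso | easy].
(* By continuity [a] keeps half its value on an interval whose right end stays strictly below [T],
   where the weight is exponentially larger than at [T]. *)
assert (Hcont : exists s1, s < s1 < T /\ forall x, s <= x <= s1 -> a s / 2 <= a x).
{ assert (C : continuity_pt a s)
    by (apply derivable_continuous_pt, ex_derive_Reals_0; eexists; apply Ha).
  destruct (C (a s / 2)) as (d & Hd & Hc); [lra|].
  exists (s + Rmin d (T - s) / 2).
  assert (0 < Rmin d (T - s)) by (apply Rmin_glb_lt; lra).
  assert (I1 := Rmin_l d (T - s)); assert (I2 := Rmin_r d (T - s)).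
  split; [lra|].
  intros x Hx.
  destruct (Req_dec x s) as [->|Hn]; [lra|].
  assert (Hx' : R_dist (a x) (a s) < a s / 2).
  { apply Hc; split; [split; [exact I|lra]|].
    simpl; unfold R_dist; rewrite Rabs_pos_eq; lra. }
  unfold R_dist in Hx'; apply Rabs_def2 in Hx'; lra. }
destruct Hcont as (s1 & Hs1 & Hlow).
(* At t = T one has p = -tau. The terms in [a] are then nonnegative, and the others are at least -(2
   tau |D T| + (4 tau^2 + 2 tau) |b T|), so for tau >= 1 the factor of the weight is at least -C
   tau^3. *)
set (C := 2 * Rabs (D T) + 6 * Rabs (b T)).
destruct (exp_not_le_cubic ((s1 - s) * (a s / 2)) (2 * (T - s1)) C M)
  as (tau & HM & H1 & Hexp); [nra | lra |].
assert (Q0 : carleman tau 0 = 0)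
  by (unfold carleman; rewrite Ha0, Hb0, HD0; ring).
assert (Qs := carleman_decreasing tau 0 s H1 HM ltac:(lra) ltac:(lra) ltac:(lra)).
assert (QT := carleman_decreasing tau s1 T H1 HM ltac:(lra) ltac:(lra) ltac:(lra)).
set (ex := exp (tau * (s1 - (T + 1)) ^ 2)).
assert (Qm : carleman tau s1 - carleman tau s <= - ((s1 - s) * (a s / 2) * ex)).
{ destruct (MVT_gen (carleman tau) s s1 (Derive (carleman tau))) as (c & Hc & E).
  - intros x Hx; apply Derive_correct; eexists; apply carleman_derive.
  - intros x Hx; apply derivable_continuous_pt, ex_derive_Reals_0.
    eexists; apply carleman_derive.
  - rewrite Rmin_left, Rmax_right in Hc by lra.
    destruct (carleman_derive_le tau c) as (l & Hl & Hle); try lra.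
    rewrite (is_derive_unique _ _ _ Hl) in E.
    (* The weight decreases on [s, s1], so its value at [s1] bounds it from below there. *)
    assert (Hex : ex <= exp (tau * (c - (T + 1)) ^ 2)).
    { apply exp_nondecreasing; apply Rmult_le_compat_l; nra. }
    assert (a s / 2 * ex <= a c * exp (tau * (c - (T + 1)) ^ 2)).
    { apply Rmult_le_compat; auto; [lra | left; apply exp_pos]. }
    rewrite E.
    nra. }
assert (QTl : - (exp tau * (C * tau ^ 3)) <= carleman tau T).
{ unfold carleman.
  replace ((T - (T + 1)) ^ 2) with 1 by ring; rewrite Rmult_1_r.
  rewrite <- Ropp_mult_distr_r_reverse.
  apply Rmult_le_compat_l; [left; apply exp_pos|].
  assert (T0 : 0 <= tau ^ 2) by (apply pow_le; lra).
  assert (T1 : 0 <= tau ^ 3) by (apply pow_le; lra).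
  assert (T2 : tau <= tau ^ 3) by nra.
  assert (T3 : tau ^ 2 <= tau ^ 3) by nra.
  assert (A := a_ge_0 T).
  assert (B1 := Rle_abs (b T)); assert (B2 := Rabs_maj2 (b T)).
  assert (E1 := Rle_abs (D T)); assert (E2 := Rabs_maj2 (D T)).
  assert (tau * Rabs (D T) <= tau ^ 3 * Rabs (D T))
    by (apply Rmult_le_compat_r; [apply Rabs_pos | lra]).
  assert (tau * Rabs (b T) <= tau ^ 3 * Rabs (b T))
    by (apply Rmult_le_compat_r; [apply Rabs_pos | lra]).
  assert (tau ^ 2 * Rabs (b T) <= tau ^ 3 * Rabs (b T))
    by (apply Rmult_le_compat_r; [apply Rabs_pos | lra]).
  assert (tau * - Rabs (D T) <= tau * D T) by (apply Rmult_le_compat_l; lra).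
  assert (tau * b T <= tau * Rabs (b T)) by (apply Rmult_le_compat_l; lra).
  assert (tau ^ 2 * b T <= tau ^ 2 * Rabs (b T)) by (apply Rmult_le_compat_l; lra).
  assert (0 <= tau ^ 3 * a T) by (apply Rmult_le_pos; lra).
  assert (0 <= tau ^ 2 * a T) by (apply Rmult_le_pos; lra).
  replace (T - (T + 1)) with (-1) by ring.
  unfold C; ring_simplify.
  lra. }
assert (Hex : exp tau * exp (2 * (T - s1) * tau) <= ex).
{ rewrite <- exp_plus; apply exp_nondecreasing.
  replace (tau * (s1 - (T + 1)) ^ 2)
    with (tau + 2 * (T - s1) * tau + tau * (T - s1) ^ 2) by ring.
  assert (0 <= tau * (T - s1) ^ 2) by (apply Rmult_le_pos; [lra | apply pow2_ge_0]).
  lra. }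
assert (F1 : exp tau * (C * tau ^ 3) <
             exp tau * ((s1 - s) * (a s / 2) * exp (2 * (T - s1) * tau)))
  by (apply Rmult_lt_compat_l; [apply exp_pos | exact Hexp]).
assert (F2 : (s1 - s) * (a s / 2) * (exp tau * exp (2 * (T - s1) * tau)) <=
             (s1 - s) * (a s / 2) * ex) by (apply Rmult_le_compat_l; nra).
lra.
Qed.

End Energy.

(** * Unique continuation for periodic functions on a strip *)

Lemma slice_int_lin3 (c : R) (u v w : R -> R -> R) (p q r t : R) :
  cont2 u -> cont2 v -> cont2 w ->
  slice_int c (fun t x => p * u t x + q * v t x + r * w t x) t =
  p * slice_int c u t + q * slice_int c v t + r * slice_int c w t.
Proof.
intros Hu Hv Hw.
assert (K : forall k f, cont2 f -> cont2 (fun t x : R => k * f t x))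
  by (intros k f Hf; apply (cont2_mult (fun _ _ => k)); [apply (Ck_const 0) | exact Hf]).
rewrite (slice_int_plus c (fun t x => p * u t x + q * v t x) (fun t x => r * w t x)),
  (slice_int_plus c (fun t x => p * u t x) (fun t x => q * v t x)), !slice_int_scal;
  auto using cont2_plus.
Qed.

(** This is the integral of (u + p v + q w)^2 multiplied out. It provides both quadratic-form
    hypotheses of the energy argument. *)
Lemma slice_int_square_ge_0 (c : R) (u v w : R -> R -> R) (p q t : R) : 0 <= c ->
  cont2 u -> cont2 v -> cont2 w ->
  0 <= slice_int c (fun t x => u t x * u t x) t
    + p ^ 2 * slice_int c (fun t x => v t x * v t x) t
    + q ^ 2 * slice_int c (fun t x => w t x * w t x) t
    + 2 * p * slice_int c (fun t x => u t x * v t x) t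
    + 2 * q * slice_int c (fun t x => u t x * w t x) t
    + 2 * p * q * slice_int c (fun t x => v t x * w t x) t.
Proof.
intros Hc Hu Hv Hw.
assert (E := slice_int_lin3 c (fun t x => 1 * (u t x * u t x) + p ^ 2 * (v t x * v t x)
                             + q ^ 2 * (w t x * w t x))
        (fun t x => (2 * p) * (u t x * v t x) + (2 * q) * (u t x * w t x)
           + (2 * p * q) * (v t x * w t x)) (fun _ _ => 0) 1 1 0 t).
assert (K : forall k f, cont2 f -> cont2 (fun t x : R => k * f t x))
  by (intros k f Hf; apply (cont2_mult (fun _ _ => k)); [apply (Ck_const 0) | exact Hf]).
rewrite (slice_int_lin3 c (fun t x => u t x * u t x) (fun t x => v t x * v t x)
  (fun t x => w t x * w t x)) in E by auto using cont2_mult.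
rewrite (slice_int_lin3 c (fun t x => u t x * v t x) (fun t x => u t x * w t x)
  (fun t x => v t x * w t x)) in E by auto using cont2_mult.
match type of E with ?A -> _ => assert (E1 : A) by auto 10 using cont2_plus, cont2_mult end.
match type of E with _ -> ?A -> _ => assert (E2 : A) by auto 10 using cont2_plus, cont2_mult end.
specialize (E E1 E2 (Ck_const 0 0)).
match type of E with slice_int _ ?f _ = _ => assert (P : 0 <= slice_int c f t) end.
{ apply slice_int_ge_0; auto.
  - repeat apply cont2_plus; apply K; auto. apply (Ck_const 0 0).
  - intros x.
    match goal with |- 0 <= ?A =>
      replace A with ((u t x + p * v t x + q * w t x) ^ 2) by ring end.
    apply pow2_ge_0. }
lra.
Qed.

Lemma D2_periodic (c : R) (f : R -> R -> R) : Ck 1 f ->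
  (forall t x, f t (x + c) = f t x) -> forall t x, D2 f t (x + c) = D2 f t x.
Proof.
intros Hf H t x; symmetry; apply is_derive_unique.
apply (is_derive_ext (fun x => f t (x + c))); [intros; apply H|].
replace (D2 f t (x + c)) with (scal 1 (D2 f t (x + c))) by apply Rmult_1_l.
apply (is_derive_comp (fun x => f t x) (fun x => x + c)).
- eapply is_derive_D2, Hf.
- auto_derive; auto.
Qed.

Lemma D1_periodic (c : R) (f : R -> R -> R) :
  (forall t x, f t (x + c) = f t x) -> forall t x, D1 f t (x + c) = D1 f t x.
Proof. intros H t x; apply Derive_ext; intros; apply H. Qed.

(** Periodicity removes all boundary terms in x, so the slice integrals of [w] and its derivatives
    satisfy the energy identities. The pointwise bound on the Laplacian becomes int f^2 <= L^2 int
    w^2, and the vanishing Cauchy data give the initial values. *)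
Lemma periodic_unique_continuation (c L T : R) (w : R -> R -> R) :
  0 < c -> Ck 2 w ->
  (forall t x, w t (x + c) = w t x) ->
  (forall t x, 0 <= t <= T -> 0 < x < c -> Rabs (Lap w t x) <= L * Rabs (w t x)) ->
  (forall x, w 0 x = 0) -> (forall x, D1 w 0 x = 0) ->
  forall t x, 0 <= t < T -> 0 < x < c -> w t x = 0.
Proof.
intros Hc Hw Hper HL H0 H0' t x Ht Hx.
set (w1 := D1 w); set (w2 := D2 w); set (f := Lap w).
assert (Cw1 : Ck 1 w1) by now apply Ck_D1.
assert (Cw2 : Ck 1 w2) by now apply Ck_D2.
assert (Cw : Ck 1 w) by now apply Ck_pred.
assert (Kw := Ck_cont2 _ _ Cw); assert (K1 := Ck_cont2 _ _ Cw1);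
  assert (K2 := Ck_cont2 _ _ Cw2).
assert (K11 : cont2 (D1 w1)) by now apply (Ck_D1 0).
assert (K22 : cont2 (D2 w2)) by now apply (Ck_D2 0).
assert (K21 : cont2 (D2 w1)) by now apply (Ck_D2 0).
assert (Kf : cont2 f) by now apply (cont2_plus (D1 w1) (D2 w2)).
assert (P1 := D1_periodic c w Hper); fold w1 in P1.
assert (P2 := D2_periodic c w Cw Hper); fold w2 in P2.
assert (Hend : forall g : R -> R -> R, (forall t x, g t (x + c) = g t x) ->
  forall t, g t c = g t 0)
  by (intros g Hg s; rewrite <- (Hg s 0); f_equal; ring).
set (J := fun u v : R -> R -> R => slice_int c (fun t x => u t x * v t x)).
assert (Jlin : forall t u v, J u v t = J v u t)
  by (intros; apply slice_int_ext; intros; ring).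
assert (Jpos : forall u t, cont2 u -> 0 <= J u u t).
{ intros u s Hu; apply slice_int_ge_0; [lra | now apply cont2_mult | intros; nra]. }
assert (Jd : forall u v t, Ck 1 u -> Ck 1 v ->
  is_derive (J u v) t (J (D1 u) v t + J u (D1 v) t)).
{ intros u v s Hu Hv.
  assert (E := is_derive_slice_int c _ s (Ck_mult 1 u v Hu Hv)).
  rewrite (proj1 (D_mult u v Hu Hv)) in E.
  rewrite (slice_int_plus c (fun t x => D1 u t x * v t x) (fun t x => u t x * D1 v t x))
    in E; [exact E | |];
    apply cont2_mult; first [now apply (Ck_D1 0) | now apply (Ck_cont2 1)]. }
assert (Jp : forall u v t, Ck 1 u -> Ck 1 v -> (forall t x, u t (x + c) = u t x) ->
  (forall t x, v t (x + c) = v t x) -> J u (D2 v) t = - J (D2 u) v t)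
  by (intros; apply slice_int_by_parts; auto).
assert (Jf : forall u t, cont2 u -> J u (D1 w1) t = J u f t - J u (D2 w2) t).
{ intros u s Hu; unfold J.
  enough (slice_int c (fun t x => u t x * f t x) s =
    slice_int c (fun t x => u t x * D1 w1 t x) s +
    slice_int c (fun t x => u t x * D2 w2 t x) s) by lra.
  rewrite <- slice_int_plus by now apply cont2_mult.
  apply slice_int_ext; intros y; unfold f, Lap; fold w1 w2; ring. }
assert (Hcomm : D1 w2 = D2 w1) by now apply D1_D2_comm.
assert (HJ0 : forall u v, (forall x, v 0 x = 0) -> J u v 0 = 0).
{ intros u v Hv; unfold J.
  rewrite (slice_int_ext c _ (fun _ _ => 0)) by (intros; rewrite Hv; ring).
  unfold slice_int; rewrite RInt_const; apply Rmult_0_r. }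
assert (Ha : J w w t = 0).
{ apply (energy_eq_0 (J w w) (J w1 w) (J w1 w1) (fun t => J w1 w1 t - J w2 w2 t)
    (J f w) (J f w1) (J f f) T (L ^ 2)); auto.
  - intros s.
    replace (2 * J w1 w s) with (J w1 w s + J w w1 s) by (rewrite (Jlin s w w1); ring).
    now apply Jd.
  - intros s.
    (* Replace w_tt by f - w_xx and integrate by parts: - int w w_xx = int w_x^2, which is [e - D]
       in the energy notation. *)
    replace (2 * J w1 w1 s - (J w1 w1 s - J w2 w2 s) + J f w s)
      with (J (D1 w1) w s + J w1 w1 s); [now apply Jd|].
    rewrite (Jlin s (D1 w1) w), Jf, (Jp w w2), (Jlin s w f) by auto.
    fold w2; ring.
  - intros s.
    (* After w_tt = f - w_xx, one integration by parts gives - int w_t w_xx = int w_tx w_x. This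
       cancels the derivative of int w_x^2 because mixed partials commute. *)
    replace (2 * J f w1 s) with
      ((J (D1 w1) w1 s + J w1 (D1 w1) s) - (J (D1 w2) w2 s + J w2 (D1 w2) s)).
    + apply (is_derive_minus (J w1 w1) (J w2 w2)); now apply Jd.
    + rewrite (Jlin s (D1 w1) w1), Jf, (Jp w1 w2) by auto.
      rewrite (Jlin s w2 (D1 w2)), Hcomm, (Jlin s f w1); ring.
  - intros s al be. apply (slice_int_square_ge_0 c f w1 w); auto; lra.
  - intros s p.
    assert (Q := slice_int_square_ge_0 c w1 w (fun _ _ => 0) p 0 s).
    fold (J w1 w1) (J w w) (J w1 w) in Q.
    specialize (Q ltac:(lra) K1 Kw (Ck_const 0 0)); lra.
  - intros s Hs; unfold J.
    rewrite <- slice_int_scal by now apply cont2_mult.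
    apply slice_int_le; try lra; try (now apply cont2_mult).
    + apply (cont2_mult (fun _ _ => L ^ 2)); [apply (Ck_const 0) | now apply cont2_mult].
    + intros y Hy; assert (B := HL s y Hs Hy); fold f in B.
      replace (f s y * f s y) with (Rabs (f s y) ^ 2)
        by (rewrite pow2_abs; ring).
      replace (L ^ 2 * (w s y * w s y)) with ((L * Rabs (w s y)) ^ 2)
        by (rewrite Rpow_mult_distr, pow2_abs; ring).
      apply pow_incr; split; [apply Rabs_pos | exact B].
  - rewrite (HJ0 w1 w1), (HJ0 w2 w2); auto; [ring|].
    intros y; unfold w2, D2.
    rewrite (Derive_ext _ (fun _ => 0)) by (intros; apply H0).
    apply Derive_const. }
assert (E := slice_int_eq_0 c (fun t x => w t x * w t x) t x
  (cont2_mult _ _ Kw Kw) ltac:(intros; nra) Ha Hx).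
simpl in E; nra.
Qed.

(** * Log-polar coordinates and the conformal Laplacian *)

Section LogPolar.

Variables r sg : R.

(** The sign [sg] sends t >= 0 to the outside (1) or the inside (-1) of the circle of radius [r], so
    one forward argument in t serves both sides. *)
Definition polX (t x : R) : R := r * exp (sg * t) * cos x.
Definition polY (t x : R) : R := r * exp (sg * t) * sin x.
Definition polar (f : R -> R -> R) (t x : R) : R := f (polX t x) (polY t x).

Lemma is_derive_polX1 (t x : R) : is_derive (fun t => polX t x) t (sg * polX t x).
Proof. unfold polX; auto_derive; [easy | ring]. Qed.

Lemma is_derive_polX2 (t x : R) : is_derive (fun x => polX t x) x (- polY t x).
Proof. unfold polX, polY; auto_derive; [easy | ring]. Qed.

Lemma is_derive_polY1 (t x : R) : is_derive (fun t => polY t x) t (sg * polY t x).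
Proof. unfold polY; auto_derive; [easy | ring]. Qed.

Lemma is_derive_polY2 (t x : R) : is_derive (fun x => polY t x) x (polX t x).
Proof. unfold polX, polY; auto_derive; [easy | ring]. Qed.

Lemma cont2_fst_derivable (f : R -> R) : (forall t, ex_derive f t) -> cont2 (fun t _ => f t).
Proof.
intros H x y; apply (continuous_comp (fun p : R * R => fst p) f).
- apply continuous_fst.
- exact (ex_derive_continuous f x (H x)).
Qed.

Lemma cont2_snd_derivable (f : R -> R) : (forall t, ex_derive f t) -> cont2 (fun _ t => f t).
Proof.
intros H x y; apply (continuous_comp (fun p : R * R => snd p) f).
- apply continuous_snd.
- exact (ex_derive_continuous f y (H y)).
Qed.

Lemma Ck_polXY (k : nat) : Ck k polX /\ Ck k polY.
Proof.
assert (CX : cont2 polX).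
{ apply (cont2_mult (fun t _ => r * exp (sg * t)) (fun _ x => cos x)).
  - apply (cont2_fst_derivable (fun t => r * exp (sg * t))); intros; auto_derive; easy.
  - apply (cont2_snd_derivable cos); intros; auto_derive; easy. }
assert (CY : cont2 polY).
{ apply (cont2_mult (fun t _ => r * exp (sg * t)) (fun _ x => sin x)).
  - apply (cont2_fst_derivable (fun t => r * exp (sg * t))); intros; auto_derive; easy.
  - apply (cont2_snd_derivable sin); intros; auto_derive; easy. }
induction k as [|k [IX IY]]; [now split|].
assert (S : forall a f, Ck k f -> Ck k (fun t x => a * f t x))
  by (intros a f Hf; apply (Ck_mult k (fun _ _ => a)); [apply Ck_const | exact Hf]).
split.
- apply (Ck_intro k polX (fun t x => sg * polX t x) (fun t x => - polY t x));
    auto using is_derive_polX1, is_derive_polX2.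
  replace (fun t x => - polY t x) with (fun t x => (-1) * polY t x); auto.
  extensionality t; extensionality x; ring.
- apply (Ck_intro k polY (fun t x => sg * polY t x) polX);
    auto using is_derive_polY1, is_derive_polY2.
Qed.

Lemma Ck_polar (k : nat) (f : R -> R -> R) : Ck k f -> Ck k (polar f).
Proof. intros Hf; apply (Ck_comp k f polX polY); [exact Hf | apply Ck_polXY | apply Ck_polXY]. Qed.

Lemma is_derive_polar1 (f : R -> R -> R) (t x : R) : Ck 1 f ->
  is_derive (fun t => polar f t x) t
    (sg * (polX t x * polar (D1 f) t x + polY t x * polar (D2 f) t x)).
Proof.
intros Hf.
replace (sg * (polX t x * polar (D1 f) t x + polY t x * polar (D2 f) t x))
  with (polar (D1 f) t x * (sg * polX t x) + polar (D2 f) t x * (sg * polY t x)) by ring.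
apply (is_derive_comp2 f (fun t => polX t x) (fun t => polY t x)); auto.
- apply is_derive_polX1.
- apply is_derive_polY1.
Qed.

Lemma is_derive_polar2 (f : R -> R -> R) (t x : R) : Ck 1 f ->
  is_derive (fun x => polar f t x) x
    (polX t x * polar (D2 f) t x - polY t x * polar (D1 f) t x).
Proof.
intros Hf.
replace (polX t x * polar (D2 f) t x - polY t x * polar (D1 f) t x)
  with (polar (D1 f) t x * (- polY t x) + polar (D2 f) t x * polX t x) by ring.
apply (is_derive_comp2 f (fun x => polX t x) (fun x => polY t x)); auto.
- apply is_derive_polX2.
- apply is_derive_polY2.
Qed.

Lemma D1_polar (f : R -> R -> R) : Ck 1 f -> D1 (polar f) = fun t x =>
  sg * (polX t x * polar (D1 f) t x + polY t x * polar (D2 f) t x).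
Proof.
intros Hf; extensionality t; extensionality x.
apply is_derive_unique, is_derive_polar1, Hf.
Qed.

Lemma D2_polar (f : R -> R -> R) : Ck 1 f -> D2 (polar f) = fun t x =>
  polX t x * polar (D2 f) t x - polY t x * polar (D1 f) t x.
Proof.
intros Hf; extensionality t; extensionality x.
apply is_derive_unique, is_derive_polar2, Hf.
Qed.

(** The conformal factor of the change of variables, namely the squared distance to the origin. *)
Definition conf (t : R) : R := (r * exp (sg * t)) ^ 2.

Lemma conf_eq (t x : R) : conf t = polX t x ^ 2 + polY t x ^ 2.
Proof.
unfold conf, polX, polY; assert (H := sin2_cos2 x); unfold Rsqr in H.
transitivity ((r * exp (sg * t)) ^ 2 * (sin x * sin x + cos x * cos x)).
- rewrite H; ring.
- ring.
Qed.

Hypothesis sg2 : sg * sg = 1.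

(** In the sum of the two second derivatives the first-order terms cancel because sg^2 = 1, and the
    mixed second-order terms cancel too. What remains is X^2 + Y^2 times the Laplacian. *)
Lemma Lap_polar (f : R -> R -> R) : Ck 2 f ->
  Lap (polar f) = fun t x => conf t * polar (Lap f) t x.
Proof.
intros Hf; extensionality t; extensionality x; unfold Lap at 1.
assert (C1 : Ck 1 f) by now apply Ck_pred.
assert (Cx : Ck 1 (D1 f)) by now apply Ck_D1.
assert (Cy : Ck 1 (D2 f)) by now apply Ck_D2.
rewrite D1_polar, D2_polar by auto.
set (X := polX t x); set (Y := polY t x).
assert (E1 : D1 (fun t x => sg * (polX t x * polar (D1 f) t x + polY t x * polar (D2 f) t x))
  t x = sg * ((sg * X * polar (D1 f) t x
               + X * (sg * (X * polar (D1 (D1 f)) t x + Y * polar (D2 (D1 f)) t x)))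
            + (sg * Y * polar (D2 f) t x
               + Y * (sg * (X * polar (D1 (D2 f)) t x + Y * polar (D2 (D2 f)) t x))))).
{ apply is_derive_unique, (is_derive_scal (fun t => _)).
  apply @is_derive_plus.
  - apply (is_derive_mult (fun t => polX t x) (fun t => polar (D1 f) t x));
      [apply is_derive_polX1 | now apply is_derive_polar1 | exact Rmult_comm].
  - apply (is_derive_mult (fun t => polY t x) (fun t => polar (D2 f) t x));
      [apply is_derive_polY1 | now apply is_derive_polar1 | exact Rmult_comm]. }
assert (E2 : D2 (fun t x => polX t x * polar (D2 f) t x - polY t x * polar (D1 f) t x)
  t x = ((- Y) * polar (D2 f) t x
               + X * (X * polar (D2 (D2 f)) t x - Y * polar (D1 (D2 f)) t x))
        - (X * polar (D1 f) t x
               + Y * (X * polar (D2 (D1 f)) t x - Y * polar (D1 (D1 f)) t x))).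
{ apply is_derive_unique, @is_derive_minus.
  - apply (is_derive_mult (fun x => polX t x) (fun x => polar (D2 f) t x));
      [apply is_derive_polX2 | now apply is_derive_polar2 | exact Rmult_comm].
  - apply (is_derive_mult (fun x => polY t x) (fun x => polar (D1 f) t x));
      [apply is_derive_polY2 | now apply is_derive_polar2 | exact Rmult_comm]. }
rewrite E1, E2, (conf_eq t x); fold X Y.
change (polar (Lap f) t x) with (polar (D1 (D1 f)) t x + polar (D2 (D2 f)) t x).
match goal with |- sg * ?A + _ = _ =>
  replace (sg * A) with (sg * sg * (X * polar (D1 f) t x
               + X * (X * polar (D1 (D1 f)) t x + Y * polar (D2 (D1 f)) t x)
            + (Y * polar (D2 f) t x
               + Y * (X * polar (D1 (D2 f)) t x + Y * polar (D2 (D2 f)) t x)))) by ring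
end.
rewrite sg2; ring.
Qed.

End LogPolar.

(** Two uses of symmetry of mixed partials. It lets the angular derivative of phi inherit an
    equation from the Laplacian of phi. *)
Lemma Lap_D2 (u : R -> R -> R) : Ck 3 u -> Lap (D2 u) = D2 (Lap u).
Proof.
intros H; extensionality t; extensionality x; symmetry.
assert (C2 : Ck 2 u) by now apply Ck_pred.
apply is_derive_unique; unfold Lap.
rewrite (D1_D2_comm u C2), (D1_D2_comm (D1 u)) by now apply Ck_D1.
apply @is_derive_plus.
- apply (is_derive_D2 0), Ck_D1, Ck_D1, H.
- apply (is_derive_D2 0), Ck_D2, Ck_D2, H.
Qed.

(** * Circles and the set I in terms of the angle *)

(** The angle is [acos (x / r)] on the upper half circle and its reflection [2 * PI - acos (x / r)]
    on the lower half. *)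
Lemma polar_coordinates (r x y : R) : 0 < r -> nrm x y = r ->
  exists th, 0 <= th <= 2 * PI /\ x = r * cos th /\ y = r * sin th.
Proof.
intros Hr H; unfold nrm in H.
assert (S : x ^ 2 + y ^ 2 = r ^ 2).
{ rewrite <- H, pow2_sqrt; [easy|]; assert (A := pow2_ge_0 x); assert (B := pow2_ge_0 y); lra. }
assert (B : -1 <= x / r <= 1).
{ assert (- r <= x <= r) by (split; nra).
  split; apply Rmult_le_reg_r with r; auto; unfold Rdiv;
    rewrite Rmult_assoc, Rinv_l; lra. }
assert (Hs : r * sin (acos (x / r)) = Rabs y).
{ rewrite sin_acos by exact B.
  rewrite <- (sqrt_pow2 r) at 1 by lra.
  rewrite <- sqrt_mult_alt by apply pow2_ge_0.
  replace (r ^ 2 * (1 - (x / r)²)) with (Rsqr y) by (unfold Rsqr; field_simplify; lra).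
  apply sqrt_Rsqr_abs. }
assert (Hc : x = r * cos (acos (x / r))) by (rewrite cos_acos by exact B; field; lra).
assert (A := acos_bound (x / r)); assert (P := PI_RGT_0).
destruct (Rle_dec 0 y) as [Hy|Hy].
- exists (acos (x / r)); repeat split; try lra.
  rewrite Hs, Rabs_pos_eq; lra.
- exists (2 * PI - acos (x / r)); repeat split; try lra.
  + rewrite cos_minus, cos_2PI, sin_2PI; lra.
  + rewrite sin_minus, cos_2PI, sin_2PI.
    rewrite Rabs_left in Hs; lra.
Qed.

Lemma nrm_polar (r th : R) : 0 <= r -> nrm (r * cos th) (r * sin th) = r.
Proof.
intros Hr; unfold nrm.
replace ((r * cos th) ^ 2 + (r * sin th) ^ 2) with (r ^ 2).
- now apply sqrt_pow2.
- assert (H := sin2_cos2 th); unfold Rsqr in H.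
  transitivity (r ^ 2 * (sin th * sin th + cos th * cos th)); [rewrite H|]; ring.
Qed.

Lemma Iset_D2_polar (phi : R -> R -> R) (r sg t : R) :
  0 < r -> Iset phi (r * exp (sg * t)) -> forall x, D2 (polar r sg phi) t x = 0.
Proof.
intros Hr [_ H] x; apply is_derive_unique.
apply (is_derive_ext (fun _ => polar r sg phi t 0)); [|apply (is_derive_const (polar r sg phi t 0))].
assert (0 < exp (sg * t)) by apply exp_pos.
intros y; apply H; apply nrm_polar; nra.
Qed.

(** The mean value theorem compares every angle with angle 0. It uses the derivative only at
    interior angles, which is where unique continuation provides its vanishing. *)
Lemma D2_polar_Iset (phi : R -> R -> R) (r sg t : R) : Ck 1 phi ->
  0 < r -> (forall x, 0 < x < 2 * PI -> D2 (polar r sg phi) t x = 0) ->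
  Iset phi (r * exp (sg * t)).
Proof.
intros Hphi Hr H.
assert (Hp : 0 < r * exp (sg * t)) by (apply Rmult_lt_0_compat; [exact Hr | apply exp_pos]).
assert (Cu := Ck_polar r sg 1 phi Hphi).
assert (K : forall th, 0 <= th <= 2 * PI -> polar r sg phi t th = polar r sg phi t 0).
{ intros th Hth.
  destruct (Req_dec th 0) as [->|Hn]; [easy|].
  destruct (MVT_cor2 (polar r sg phi t) (D2 (polar r sg phi) t) 0 th) as (c & E & Hc).
  - lra.
  - intros c Hc; apply is_derive_Reals, (is_derive_D2 0), Cu.
  - rewrite H in E by lra; lra. }
split; [lra|].
intros x1 y1 x2 y2 H1 H2.
destruct (polar_coordinates _ _ _ Hp H1) as (th1 & B1 & -> & ->).
destruct (polar_coordinates _ _ _ Hp H2) as (th2 & B2 & -> & ->).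
transitivity (polar r sg phi t 0); [|symmetry]; now apply K.
Qed.

(** * Local estimates near the circle *)

(** Uniform continuity on [0, 1] x [0, c] yields one [d] for the whole slice. This later keeps u_t
    away from 0 near the circle. *)
Lemma cont2_near_slice (c eps : R) (f : R -> R -> R) : cont2 f -> 0 < eps ->
  exists d, 0 < d /\ forall t x, 0 <= t <= d -> 0 <= x <= c -> Rabs (f t x - f 0 x) < eps.
Proof.
intros Hf He.
destruct (uniform_continuity_2d f 0 1 0 c) with (eps := mkposreal eps He) as [d Hd].
- intros; now apply cont2_continuity_2d_pt.
- assert (P := cond_pos d).
  exists (Rmin 1 (d / 2)); split; [apply Rmin_glb_lt; lra|].
  intros t x Ht Hx.
  assert (A := Rmin_l 1 (d / 2)); assert (B := Rmin_r 1 (d / 2)).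
  apply (Hd 0 x t x); try lra.
  + rewrite Rminus_0_r, Rabs_pos_eq; lra.
  + rewrite Rminus_diag, Rabs_R0; lra.
Qed.

Lemma cont2_bounded_near_slice (c : R) (f : R -> R -> R) : cont2 f ->
  exists d B, 0 < d /\ forall t x, 0 <= t <= d -> 0 <= x <= c -> Rabs (f t x) <= B.
Proof.
intros Hf.
destruct (cont2_near_slice c 1 f Hf Rlt_0_1) as (d & Hd & H).
destruct (bounded_continuity (V := R_NormedModule) (fun x => f 0 x) 0 c) as [M HM].
- intros x _; exact (cont2_continuous_2 f 0 x Hf).
- exists d, (M + 1); split; [exact Hd|].
  intros t x Ht Hx.
  assert (A := H t x Ht Hx).
  assert (B : Rabs (f 0 x) < M) by exact (HM x Hx).
  apply Rabs_def2 in A; apply Rabs_def2 in B; apply Rabs_le; lra.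
Qed.

(** Translates closeness of a radius to [r] into closeness of its logarithmic coordinate to 0. *)
Lemma ln_ratio_small (r d : R) : 0 < r -> 0 < d ->
  exists eps, 0 < eps /\ forall s, Rabs (s - r) < eps -> 0 < s /\ Rabs (ln (s / r)) < d.
Proof.
intros Hr Hd.
assert (E1 : 1 < exp d) by (rewrite <- exp_0; now apply exp_increasing).
assert (E2 : exp (- d) < 1) by (rewrite <- exp_0; apply exp_increasing; lra).
assert (E3 := exp_pos (- d)).
exists (Rmin (r * (exp d - 1)) (r * (1 - exp (- d)))); split.
- apply Rmin_glb_lt; apply Rmult_lt_0_compat; lra.
- intros s Hs.
  assert (A := Rmin_l (r * (exp d - 1)) (r * (1 - exp (- d)))).
  assert (B := Rmin_r (r * (exp d - 1)) (r * (1 - exp (- d)))).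
  apply Rabs_def2 in Hs.
  assert (L1 : s < r * exp d) by lra.
  assert (L2 : r * exp (- d) < s) by lra.
  assert (Ps : 0 < s) by nra.
  assert (Pq : 0 < s / r) by now apply Rdiv_lt_0_compat.
  assert (Es : s = r * (s / r)) by (field; lra).
  split; [exact Ps|].
  apply Rabs_def1.
  + rewrite <- (ln_exp d); apply ln_increasing; [exact Pq|].
    apply Rmult_lt_reg_l with r; lra.
  + rewrite <- (ln_exp (- d)); apply ln_increasing; [exact E3|].
    apply Rmult_lt_reg_l with r; lra.
Qed.

(** Difference quotients at the zeros are 0. For nonzero [l], tolerance |l| would give |l| < |l|. *)
Lemma derive_0_of_accumulating_zeros (f : R -> R) (t l : R) :
  is_derive f t l -> f t = 0 ->
  (forall d, 0 < d -> exists s, s <> t /\ Rabs (s - t) < d /\ f s = 0) -> l = 0.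
Proof.
intros Hf H0 Hz.
destruct (Req_dec l 0) as [|Hl]; [easy | exfalso].
apply is_derive_Reals in Hf.
assert (Hp := Rabs_pos_lt l Hl).
destruct (Hf (Rabs l)) as [d Hd]; [lra|].
destruct (Hz d (cond_pos d)) as (s & Hn & Hs & E).
assert (A := Hd (s - t) ltac:(lra) Hs).
replace (t + (s - t)) with s in A by ring.
rewrite E, H0 in A.
replace ((0 - 0) / (s - t) - l) with (- l) in A by (field; lra).
rewrite Rabs_Ropp in A; lra.
Qed.

(** * One-sided neighbourhoods in I and the conclusion *)

(** The quantity assumed nonzero is [r] times the radial derivative at one point. One point suffices
    because u_t turns out to be constant on the circle. *)
Lemma Iset_one_sided_nbhd (phi : R -> R -> R) (r sg x0 y0 : R) :
  Ck 3 phi ->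
  (forall x y, - D2 phi x y * D1 (Lap phi) x y + D1 phi x y * D2 (Lap phi) x y = 0) ->
  0 < r -> sg * sg = 1 -> non_isolated (Iset phi) r ->
  nrm x0 y0 = r -> x0 * D1 phi x0 y0 + y0 * D2 phi x0 y0 <> 0 ->
  exists T, 0 < T /\ forall t, 0 <= t < T -> Iset phi (r * exp (sg * t)).
Proof.
intros Hphi Hjac Hr Hsg [HI Hacc] H0 Hne.
set (u := polar r sg phi); set (w := D2 u); set (g := polar r sg (Lap phi)).
assert (C2 : Ck 2 phi) by now apply Ck_pred.
assert (C1 : Ck 1 phi) by now apply Ck_pred.
assert (Cu : Ck 3 u) by now apply Ck_polar.
assert (Cu2 : Ck 2 u) by now apply Ck_pred.
assert (Cu1 : Ck 1 u) by now apply Ck_pred.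
assert (Cw : Ck 2 w) by now apply Ck_D2.
assert (CL : Ck 1 (Lap phi)).
{ apply (Ck_plus 1 (D1 (D1 phi)) (D2 (D2 phi))); [apply Ck_D1, Ck_D1 | apply Ck_D2, Ck_D2];
    exact Hphi. }
assert (Cg : Ck 1 g) by now apply Ck_polar.
assert (Hw0 : forall x, w 0 x = 0).
{ apply (Iset_D2_polar phi r sg 0 Hr); now rewrite Rmult_0_r, exp_0, Rmult_1_r. }
(* Radii of I close to [r] may lie on either side of it, so their coordinates [sg * ln (s / r)] may
   have either sign. Each is a zero of [w], and the derivative in t is two-sided. *)
assert (Hw1 : forall x, D1 w 0 x = 0).
{ intros x; apply (derive_0_of_accumulating_zeros (fun t => w t x) 0);
    [now apply (is_derive_D1 1) | apply Hw0 |].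
  intros d Hd.
  destruct (ln_ratio_small r d Hr Hd) as (eps & He & Hln).
  destruct (Hacc eps He) as (s & Is & Hn & Hs).
  destruct (Hln s Hs) as [Ps Hl].
  assert (Pq : 0 < s / r) by now apply Rdiv_lt_0_compat.
  assert (Es : s = r * exp (sg * (sg * ln (s / r)))).
  { rewrite <- Rmult_assoc, Hsg, Rmult_1_l, exp_ln by exact Pq; field; lra. }
  exists (sg * ln (s / r)); repeat split.
  - intros E; rewrite E, Rmult_0_r, exp_0 in Es; lra.
  - rewrite Rminus_0_r, Rabs_mult.
    assert (Rabs sg = 1).
    { assert (S : sg = 1 \/ sg = -1) by (assert ((sg - 1) * (sg + 1) = 0) by lra;
        destruct (Rmult_integral _ _ H); lra).
      destruct S as [-> | ->]; [apply Rabs_R1 | rewrite Rabs_left; lra]. }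
    rewrite H, Rmult_1_l; exact Hl.
  - apply (Iset_D2_polar phi r sg _ Hr); rewrite <- Es; exact Is. }
assert (Hpol0 : forall x, polX r sg 0 x = r * cos x /\ polY r sg 0 x = r * sin x)
  by (intros x; unfold polX, polY; rewrite Rmult_0_r, exp_0; split; ring).
destruct (polar_coordinates r x0 y0 Hr H0) as (th0 & _ & Ex0 & Ey0).
set (m := D1 u 0 th0).
assert (Hm : m <> 0).
{ unfold m, u; rewrite D1_polar by exact C1; unfold polar.
  destruct (Hpol0 th0) as [-> ->]; rewrite <- Ex0, <- Ey0.
  intros E; apply Rmult_integral in E; destruct E as [E|E]; [rewrite E in Hsg|]; lra. }
(* The angular derivative of u_t is w_t, which vanishes on the circle. *)
assert (Hconst : forall x, D1 u 0 x = m).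
{ assert (Hd : forall x, is_derive (fun x => D1 u 0 x) x 0).
  { intros x; assert (E := Hw1 x); unfold w in E; rewrite (D1_D2_comm u Cu2) in E.
    assert (K := is_derive_D2 1 (D1 u) 0 x (Ck_D1 2 u Cu)); rewrite E in K; exact K. }
  intros x; unfold m.
  destruct (Rtotal_order x th0) as [L | [-> | L]]; [|easy|].
  - now apply (eq_is_derive (fun x => D1 u 0 x)).
  - symmetry; now apply (eq_is_derive (fun x => D1 u 0 x)). }
(* The linear equation for [w], with potential V = conf g_t / u_t, cleared of its denominator. The
   Jacobian of (u, g) in log-polar coordinates is sg (X^2 + Y^2) times that of (phi, Lap phi), so
   g_x u_t = g_t w, while Lap w = conf g_x. *)
assert (Hid : forall t x, Lap w t x * D1 u t x = conf r sg t * D1 g t x * w t x).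
{ intros t x.
  assert (E : Lap w t x = conf r sg t * D2 g t x).
  { unfold w; rewrite Lap_D2 by exact Cu; unfold u; rewrite Lap_polar by auto.
    apply is_derive_unique, (is_derive_scal (fun x => polar r sg (Lap phi) t x)).
    apply (is_derive_D2 0), Cg. }
  rewrite E; unfold w, u, g; rewrite !D1_polar, !D2_polar by auto.
  assert (J : - polar r sg (D2 phi) t x * polar r sg (D1 (Lap phi)) t x
    + polar r sg (D1 phi) t x * polar r sg (D2 (Lap phi)) t x = 0) by apply Hjac.
  set (p1 := polar r sg (D1 phi) t x) in *; set (p2 := polar r sg (D2 phi) t x) in *.
  set (g1 := polar r sg (D1 (Lap phi)) t x) in *;
    set (g2 := polar r sg (D2 (Lap phi)) t x) in *.
  set (X := polX r sg t x); set (Y := polY r sg t x).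
  apply Rminus_diag_uniq.
  transitivity (conf r sg t * sg * (X ^ 2 + Y ^ 2) * (- p2 * g1 + p1 * g2)); [ring|].
  rewrite J; ring. }
assert (Kconf : cont2 (fun t x => conf r sg t * D1 g t x)).
{ apply cont2_mult; [|now apply (Ck_D1 0)].
  apply cont2_fst_derivable; intros; unfold conf; auto_derive; easy. }
destruct (cont2_bounded_near_slice (2 * PI) _ Kconf) as (d1 & B & Hd1 & HB).
assert (Pm := Rabs_pos_lt m Hm).
destruct (cont2_near_slice (2 * PI) (Rabs m / 2) (D1 u)) as (d2 & Hd2 & Hu).
{ apply (Ck_D1 0), Cu1. }
{ lra. }
exists (Rmin d1 d2); split; [now apply Rmin_glb_lt|].
intros t Ht; apply D2_polar_Iset; auto.
assert (P := PI_RGT_0).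
intros x Hx.
(* For t up to [Rmin d1 d2], |conf g_t| <= B and |u_t| >= |m|/2, which bounds the potential by 2 B /
   |m|. *)
apply (periodic_unique_continuation (2 * PI) (B * (2 / Rabs m)) (Rmin d1 d2) w);
  auto; try lra.
- apply D2_periodic; [exact Cu1|].
  intros s y; unfold u, polar, polX, polY; now rewrite cos_plus, sin_plus, cos_2PI, sin_2PI,
    !Rmult_0_r, !Rmult_1_r, Rminus_0_r, Rplus_0_r.
- intros s y Hs Hy.
  assert (M1 := Rmin_l d1 d2); assert (M2 := Rmin_r d1 d2).
  assert (I1 := HB s y ltac:(lra) ltac:(lra)); cbv beta in I1.
  assert (I2 := Hu s y ltac:(lra) ltac:(lra)); rewrite Hconst in I2.
  assert (I3 : Rabs m / 2 <= Rabs (D1 u s y)).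
  { assert (T := Rabs_triang (D1 u s y) (- (D1 u s y - m))).
    rewrite Rabs_Ropp in T.
    replace (D1 u s y + - (D1 u s y - m)) with m in T by ring; lra. }
  assert (I4 : Rabs (Lap w s y) * Rabs (D1 u s y) <= B * Rabs (w s y)).
  { rewrite <- Rabs_mult, Hid, Rabs_mult; apply Rmult_le_compat_r; auto using Rabs_pos. }
  apply Rmult_le_reg_r with (Rabs m / 2); [lra|].
  replace (B * (2 / Rabs m) * Rabs (w s y) * (Rabs m / 2)) with (B * Rabs (w s y))
    by (field; lra).
  eapply Rle_trans; [|exact I4].
  apply Rmult_le_compat_l; [apply Rabs_pos | exact I3].
Qed.

Theorem theorem1p2 (Omega : R) (phi : R -> R -> R) :
  Ck 3 phi ->
  (forall x y, - D2 phi x y * D1 (Lap phi) x y + D1 phi x y * D2 (Lap phi) x y = 0) ->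
  (exists R0, forall x y, R0 < nrm x y -> phi x y = - (Omega / 2) * (x ^ 2 + y ^ 2)) ->
  forall r : R,
    rel_boundary (Iset phi) r -> r <> 0 -> non_isolated (Iset phi) r ->
    forall x y, nrm x y = r -> D1 phi x y = 0 /\ D2 phi x y = 0.
Proof.
intros Hphi Hjac _ r [Hr0 [_ Hbd]] Hrn Hni x y Hxy.
assert (Hr : 0 < r) by lra.
assert (C1 : Ck 1 phi) by now apply Ck_pred, Ck_pred.
set (p := D1 phi x y); set (q := D2 phi x y).
assert (Hrad : x * p + y * q = 0).
{ destruct (Req_dec (x * p + y * q) 0) as [|Hne]; [easy | exfalso].
  destruct (Iset_one_sided_nbhd phi r 1 x y) as (T1 & HT1 & N1); auto; try lra.
  destruct (Iset_one_sided_nbhd phi r (-1) x y) as (T2 & HT2 & N2); auto; try lra.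
  destruct (ln_ratio_small r (Rmin T1 T2) Hr) as (eps & He & Hln);
    [now apply Rmin_glb_lt|].
  destruct (Hbd eps He) as (s & [Hs0 Hs] & Hsr).
  destruct (Hln s Hsr) as [Ps Hl].
  assert (Es : s = r * exp (ln (s / r))).
  { rewrite exp_ln; [field; lra | now apply Rdiv_lt_0_compat]. }
  assert (M1 := Rmin_l T1 T2); assert (M2 := Rmin_r T1 T2).
  apply Rabs_def2 in Hl.
  apply Hs; rewrite Es.
  destruct (Rle_dec 0 (ln (s / r))).
  - rewrite <- (Rmult_1_l (ln (s / r))); apply N1; lra.
  - replace (ln (s / r)) with (-1 * (- ln (s / r))) by ring; apply N2; lra. }
destruct (polar_coordinates r x y Hr Hxy) as (th & _ & Ex & Ey).
(* The tangential derivative vanishes because phi is constant on the circle. *)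
assert (Htan : x * q - y * p = 0).
{ assert (E := Iset_D2_polar phi r 1 0 Hr).
  rewrite Rmult_0_r, exp_0, Rmult_1_r in E.
  specialize (E (proj1 Hni) th); rewrite D2_polar in E by exact C1.
  unfold polar, polX, polY in E.
  rewrite Rmult_0_r, exp_0, Rmult_1_r, <- Ex, <- Ey in E; exact E. }
assert (S : x ^ 2 + y ^ 2 = r ^ 2).
{ rewrite Ex, Ey; assert (H := sin2_cos2 th); unfold Rsqr in H.
  transitivity (r ^ 2 * (sin th * sin th + cos th * cos th)); [|rewrite H]; ring. }
assert (P : 0 < r ^ 2) by now apply pow_lt.
(* The radial and tangential equations form a linear system for the gradient with determinant x^2 +
   y^2 = r^2 > 0. *)
split; apply Rmult_eq_reg_l with (r ^ 2); try lra; rewrite Rmult_0_r, <- S.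
- transitivity (x * (x * p + y * q) - y * (x * q - y * p)); [ring|].
  rewrite Hrad, Htan; ring.
- transitivity (y * (x * p + y * q) + x * (x * q - y * p)); [ring|].
  rewrite Hrad, Htan; ring.
Qed.
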